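(* The Weyl group $W_\lambda:=N_G(H_\lambda)/H_\lambda$ associated with $H_\lambda$ is given by $$W_\lambda=N_G(H_\lambda)/H_\lambda\simeq\prod_{1\le i\le s}\bigl(W_r(n_i)^{p_i}\rtimes\mathcal P_i\bigr).$$
   Context: Let $r,n$ be positive integers, $N=nr$, $G=\mathrm{GL}(N)=\mathrm{GL}(N,\mathbb C)$; $\mathrm{Mat}(r)$ is the set of complex $r\times r$ matrices. For a positive integer $p$, $J_r(p)\subset\mathrm{GL}(pr)$ is the group of $p\times p$ block matrices whose $(a,b)$-block ($r\times r$) is $h_{b-a}$ if $b\ge a$ and $0$ otherwise, with $h_0\in\mathrm{GL}(r)$ and $h_1,\dots,h_{p-1}\in\mathrm{Mat}(r)$. Let $\lambda$ be a partition of $n$ written as $\lambda=(\overbrace{n_1,\dots,n_1}^{p_1},\dots,\overbrace{n_s,\dots,n_s}^{p_s})$ with $n_1>n_2>\dots>n_s>0$, $p_i\ge1$, $\sum_i p_in_i=n$. Then $H_\lambda\subset G$ is the group of block-diagonal matrices whose diagonal blocks are, in this order, $p_1$ elements of $J_r(n_1)$, ..., $p_s$ elements of $J_r(n_s)$. $N_G(H_\lambda)$ is the normalizer of $H_\lambda$ in $G$. Polynomials $\mu_{i,j}$: for $x=(x_1,x_2,\dots)$ and integers $i,j\ge0$, $\mu_{i,j}(x)$ is defined by $(x_1T+x_2T^2+\cdots)^i=\sum_{j\ge0}\mu_{i,j}(x)T^j$ (with $0$-th power equal to $1$). For $0\le i,j<p$, $\mu_{i,j}$ involves only $x_1,\dots,x_{p-1}$.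 Define $$W_r(p)=\{(\mu_{i,j}(c)1_r)_{0\le i,j<p}\mid c=(c_1,\dots,c_{p-1})\in\mathbb C^{p-1},\ c_1\ne0\}\subset\mathrm{GL}(pr),$$ with $W_r(1)=\{1_r\}$. $W_r(n_i)^{p_i}$ is the group of block-diagonal matrices $\mathrm{diag}(X_1,\dots,X_{p_i})\in\mathrm{GL}(p_in_ir)$ with $X_k\in W_r(n_i)$; $\mathcal P_i\simeq\mathfrak S_{p_i}$ is the group of permutation matrices $P_\sigma=(\delta_{j,\sigma(k)}1_{n_ir})_{1\le j,k\le p_i}$, $\sigma\in\mathfrak S_{p_i}$. The semidirect product $W_r(n_i)^{p_i}\rtimes\mathcal P_i$ is the internal one in $\mathrm{GL}(p_in_ir)$, where $P_\sigma$ permutes diagonal blocks by conjugation: $P_\sigma^{-1}\mathrm{diag}(X_1,\dots,X_{p_i})P_\sigma=\mathrm{diag}(X_{\sigma(1)},\dots,X_{\sigma(p_i)})$. *)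

(* Defs.v *)
From mathcomp Require Export all_boot all_order all_algebra all_fingroup.
From mathcomp Require Export classical_sets functions reals.
From mathcomp.real_closed Require Export complex.

Set Implicit Arguments.
Unset Strict Implicit.
Unset Printing Implicit Defensive.

Import GRing.Theory.

Local Open Scope classical_set_scope.
Local Open Scope ring_scope.

Section AbstractGroups.

Definition is_group (T : Type) (mul : T -> T -> T) (A : set T) : Prop :=
  [/\ forall x y, A x -> A y -> A (mul x y),
      forall x y z, A x -> A y -> A z -> mul x (mul y z) = mul (mul x y) z
    & exists2 e, A e & forall x, A x ->
        [/\ mul e x = x, mul x e = x
          & exists2 y, A y & mul y x = e /\ mul x y = e]].

(* The groups are the subsets A of T and B of U, with the laws mulT and mulU;
   the values of f outside A are irrelevant. *)
Definition group_isomorphic (T U : Type) (mulT : T -> T -> T) (A : set T)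
    (mulU : U -> U -> U) (B : set U) : Prop :=
  [/\ is_group mulT A, is_group mulU B
    & exists f : T -> U,
        set_bij A B f /\
        forall x y, A x -> A y -> f (mulT x y) = mulU (f x) (f y)].

End AbstractGroups.

Section MatrixGroups.

Variable F : fieldType.

Definition GL (N : nat) : set 'M[F]_N := [set g | g \in unitmx].

Definition GL_normalizer (N : nat) (H : set 'M[F]_N) : set 'M[F]_N :=
  [set g | GL g /\ [set g *m h *m invmx g | h in H] = H].

Definition left_coset (N : nat) (g : 'M[F]_N) (H : set 'M[F]_N) :
  set 'M[F]_N := [set g *m h | h in H].

Definition setwise_mul (N : nat) (A B : set 'M[F]_N) : set 'M[F]_N :=
  [set a *m b | a in A & b in B].

(* The elements of N_G(H) / H; its group law is setwise_mul, for which
   (g H) (g' H) = (g *m g') H. *)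
Definition normalizer_quotient (N : nat) (H : set 'M[F]_N) :
    set (set 'M[F]_N) :=
  [set left_coset g H | g in GL_normalizer H].

(* The size p * r is kept in the form \sum_(a < p) r in which the library
   indexes matrices made of p x p blocks of size r. *)
Definition blockToeplitz (r p : nat) (h : nat -> 'M[F]_r) :
    'M[F]_(\sum_(a < p) r) :=
  \mxblock_(a < p, b < p) (if (a <= b)%N then h (b - a)%N else 0).

(* Only the entries h 0, ..., h (p - 1) of the sequence h occur. *)
Definition J (r p : nat) : set 'M[F]_(\sum_(a < p) r) :=
  [set A | exists2 h : nat -> 'M[F]_r, h 0%N \in unitmx
                                     & A = blockToeplitz p h].

(* Coefficient of T^j in (x_1 T + x_2 T^2 + ...)^i: the terms x_k T^k with
   k > j do not contribute to it, so the series is cut after T^j. *)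
Definition mu (x : nat -> F) (i j : nat) : F :=
  ((\sum_(1 <= k < j.+1) x k *: 'X^k) ^+ i)`_j.

(* Only c 1, ..., c (p - 1) occur; for p = 1 the matrix is the identity,
   whatever c is. *)
Definition W (r p : nat) : set 'M[F]_(\sum_(a < p) r) :=
  [set A | exists2 c : nat -> F, c 1%N != 0
    & A = \mxblock_(i < p, j < p) ((mu c i j)%:M : 'M[F]_r)].

Definition W_power (r n p : nat) :
    set 'M[F]_(\sum_(k < p) \sum_(a < n) r) :=
  [set A | exists2 X : 'I_p -> 'M[F]_(\sum_(a < n) r),
    forall k, W (X k) & A = \mxdiag_(k < p) X k].

Definition block_perm_mx (d p : nat) (sigma : 'S_p) :
    'M[F]_(\sum_(k < p) d) :=
  \mxblock_(j < p, k < p) ((j == sigma k)%:R%:M : 'M[F]_d).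

Definition block_perms (d p : nat) : set 'M[F]_(\sum_(k < p) d) :=
  range (@block_perm_mx d p).

(* Internal semidirect product of W_r(n)^p by the block permutations. *)
Definition W_wreath (r n p : nat) :
    set 'M[F]_(\sum_(k < p) \sum_(a < n) r) :=
  setwise_mul (@W_power r n p) (@block_perms (\sum_(a < n) r) p).

Lemma block_size (s r n : nat) (n_ p_ : 'I_s -> nat) :
  (\sum_(i < s) p_ i * n_ i)%N = n ->
  (\sum_(i < s) \sum_(k < p_ i) \sum_(a < n_ i) r)%N = (n * r)%N.
Proof.
move=> <-; rewrite big_distrl; apply: eq_bigr => i _ /=.
by rewrite !sum_nat_const !card_ord mulnA.
Qed.

Definition H_lambda (s r n : nat) (n_ p_ : 'I_s -> nat)
    (en : (\sum_(i < s) p_ i * n_ i)%N = n) : set 'M[F]_(n * r) :=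
  [set A | exists2 X : forall i : 'I_s, 'I_(p_ i) -> 'M[F]_(\sum_(a < n_ i) r),
    forall i k, J (X i k)
    & A = castmx (block_size r en, block_size r en)
            (\mxdiag_(i < s) \mxdiag_(k < p_ i) X i k)].

Definition W_product (s r : nat) (n_ p_ : 'I_s -> nat) :
    set (forall i : 'I_s, 'M[F]_(\sum_(k < p_ i) \sum_(a < n_ i) r)) :=
  [set f | forall i, W_wreath (f i)].

Definition pointwise_mul (s : nat) (d : 'I_s -> nat)
    (f g : forall i : 'I_s, 'M[F]_(d i)) : forall i : 'I_s, 'M[F]_(d i) :=
  fun i => f i *m g i.

End MatrixGroups.

(* Main.v *)
(* The idea is to read everything through centralizers.  With X the block
   shift, J is the centralizer of X in GL, and the matrices commuting with J
   are the scalar block Toeplitz matrices, i.e. F[T]/T^p with T acting as X.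
   An element g normalizing J turns X into q(X) for some q = c_1 T + ... with
   c_1 != 0; the substitution T := q, an element w of W, does the same, so that
   w^-1 g commutes with X, i.e. belongs to J.  Hence N(J) = W J, and W is the
   subgroup of N(J) fixing the first block row, so W and J meet trivially.

   An element g normalizing H_lambda maps the block idempotents e_l to
   idempotents commuting with H_lambda.  As F[T]/T^p is local, these are sums of
   block idempotents, and counting shows that g permutes the e_l; comparing
   ranks, it permutes only blocks of equal size.  Dividing g by a block
   permutation leaves a block diagonal matrix, whose blocks normalize J. *)

Require Import Defs.
From mathcomp Require boolp.

Set Implicit Arguments.
Unset Strict Implicit.
Unset Printing Implicit Defensive.

Import GRing.Theory.
Local Open Scope classical_set_scope.
Local Open Scope ring_scope.

(** * Complements in normalizers *)

Section Complement.

Variables (F : fieldType) (N : nat).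
Implicit Types (g h : 'M[F]_N) (H : set 'M[F]_N).

Record mx_subgroup H : Prop := MxSubgroup {
  mxsub_unit : forall g, H g -> g \in unitmx;
  mxsub1 : H 1%:M;
  mxsubM : forall g h, H g -> H h -> H (g *m h);
  mxsubV : forall g, H g -> H (invmx g) }.

Lemma GL_normalizerP H g :
  GL_normalizer H g <->
  g \in unitmx /\
  forall h, H h -> H (g *m h *m invmx g) /\ H (invmx g *m h *m g).
Proof.
split=> [[gU gH]|[gU gH]]; split=> //.
- move=> h Hh; split; first by rewrite -gH; exists h.
  move: Hh; rewrite -{1}gH => -[k Hk <-].
  by rewrite !mulmxA mulVmx // mul1mx mulmxKV.
- apply/seteqP; split=> [_ [h Hh <-]|h Hh]; first by case: (gH h Hh).
  exists (invmx g *m h *m g); first by case: (gH h Hh).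
  by rewrite !mulmxA mulmxV // mul1mx mulmxK.
Qed.

Lemma invmxM g h : g \in unitmx -> h \in unitmx ->
  invmx (g *m h) = invmx h *m invmx g.
Proof.
move=> gU hU; have ghU : g *m h \in unitmx by rewrite unitmx_mul gU.
apply: (can_inj (mulKmx ghU)); rewrite mulmxV // mulmxA mulmxK //.
by rewrite mulmxV.
Qed.

Lemma GL_normalizer_subgroup H : mx_subgroup (GL_normalizer H).
Proof.
split.
- by move=> g [].
- by apply/GL_normalizerP; rewrite unitmx1 invmx1; split=> // h Hh;
    rewrite !mulmx1 !mul1mx.
- move=> g h /GL_normalizerP[gU gH] /GL_normalizerP[hU hH].
  apply/GL_normalizerP; split; first by rewrite unitmx_mul gU.
  move=> k Hk; rewrite invmxM //; split.
    by have := (gH _ (hH _ Hk).1).1; rewrite !mulmxA.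
  by have := (hH _ (gH _ Hk).2).2; rewrite !mulmxA.
- move=> g /GL_normalizerP[gU gH]; apply/GL_normalizerP.
  split; first by rewrite unitmx_inv.
  by move=> h Hh; rewrite invmxK; have [] := gH h Hh.
Qed.

Lemma left_coset_eq H g h : mx_subgroup H -> g \in unitmx -> h \in unitmx ->
  left_coset g H = left_coset h H <-> H (invmx g *m h).
Proof.
move=> HG gU hU; split.
  move=> e; have : left_coset h H h.
    by exists 1%:M; [apply: mxsub1|rewrite mulmx1].
  by rewrite -e => -[k Hk <-]; rewrite mulKmx.
move=> Hgh; apply/seteqP; split=> _ [k Hk <-].
  exists (invmx (invmx g *m h) *m k).
    by apply: (mxsubM HG) => //; apply: (mxsubV HG).
  by rewrite invmxM ?unitmx_inv // invmxK !mulmxA mulmxV // mul1mx.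
exists (invmx g *m h *m k); first exact: (mxsubM HG).
by rewrite !mulmxA mulmxV // mul1mx.
Qed.

Lemma setwise_mul_coset H g h : mx_subgroup H -> GL_normalizer H h ->
  setwise_mul (left_coset g H) (left_coset h H) = left_coset (g *m h) H.
Proof.
move=> HG /GL_normalizerP[hU hH]; apply/seteqP; split.
  move=> _ [_ [a Ha <-] [_ [b Hb <-] <-]].
  exists (invmx h *m a *m h *m b).
    by apply: (mxsubM HG) => //; have [] := hH a Ha.
  by rewrite !mulmxA mulmxK.
move=> _ [a Ha <-]; exists g.
  by exists 1%:M; [apply: mxsub1|rewrite mulmx1].
by exists (h *m a); [exists a|rewrite mulmxA].
Qed.

(** The map u -> k(u) H is a homomorphism onto N(H)/H because N(H) = k(B) H, and it is injective
    because k is injective on B and k(B) meets H trivially. The group laws of the quotient are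
    transported from B along it. *)
Lemma complement_isomorphic (U : Type) (mulU : U -> U -> U) (B : set U)
    (k : U -> 'M[F]_N) (H : set 'M[F]_N) :
    mx_subgroup H -> is_group mulU B ->
    (forall u, B u -> GL_normalizer H (k u)) ->
    (forall u v, B u -> B v -> k (mulU u v) = k u *m k v) ->
    (forall u, B u -> H (k u) -> k u = 1%:M) ->
    (forall u v, B u -> B v -> k u = k v -> u = v) ->
    (forall g, GL_normalizer H g ->
       exists2 u, B u & exists2 h, H h & g = k u *m h) ->
  group_isomorphic (@setwise_mul F N) (normalizer_quotient H) mulU B.
Proof.
move=> HG Bgrp kN kM kH kinj kfull.
have NG := GL_normalizer_subgroup H.
have kU u : B u -> k u \in unitmx by move=> /kN[].
pose c u := left_coset (k u) H.
have [BM BA [e Be eP]] := Bgrp.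
have ke : k e = 1%:M.
  have := kM e e Be Be; have [-> _ _] := eP e Be => ee.
  by rewrite -(mulmxV (kU _ Be)) {2}ee mulmxK ?kU.
have kV u u' : B u -> B u' -> mulU u u' = e -> k u' = invmx (k u).
  move=> Bu Bu' uu'; apply: (can_inj (mulKmx (kU _ Bu))).
  by rewrite -kM // uu' ke mulmxV // kU.
have cinj u v : B u -> B v -> c u = c v -> u = v.
  move=> Bu Bv /(left_coset_eq HG (kU _ Bu) (kU _ Bv)).
  have [_ _ [u' Bu' [u'u uu']]] := eP u Bu.
  rewrite -(kV u u') // -kM // => /kH uv; apply: kinj => //.
  have /uv : B (mulU u' v) by apply: BM.
  rewrite kM // (kV u u') // => /(congr1 (mulmx (k u))).
  by rewrite mulKVmx ?kU // mulmx1.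
have csurj C : normalizer_quotient H C -> exists2 u, B u & C = c u.
  move=> [g gN <-]; have [u Bu [h Hh gE]] := kfull g gN.
  exists u => //; apply/left_coset_eq => //; [by case: gN|exact: kU|].
  by rewrite gE invmxM ?kU ?(mxsub_unit HG) // mulmxKV ?kU //; apply: mxsubV.
have cQ u : B u -> normalizer_quotient H (c u).
  by move=> Bu; exists (k u) => //; apply: kN.
have cM u v : B u -> B v -> setwise_mul (c u) (c v) = c (mulU u v).
  by move=> Bu Bv; rewrite /c kM // setwise_mul_coset //; apply: kN.
split=> //.
  split.
  - move=> _ _ /csurj[u Bu ->] /csurj[v Bv ->].
    by rewrite cM //; apply: cQ; apply: BM.
  - move=> _ _ _ /csurj[u Bu ->] /csurj[v Bv ->] /csurj[w Bw ->].
    by rewrite !cM ?BA //; apply: BM.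
  - exists (c e); first exact: cQ.
    move=> _ /csurj[u Bu ->]; have [eu ue [u' Bu' [u'u uu']]] := eP u Bu.
    rewrite !cM // eu ue; split=> //.
    by exists (c u'); rewrite ?cM ?u'u ?uu' //; apply: cQ.
(* The isomorphism is the inverse of [c], obtained by choice; [e] is a default value on sets that
   are not cosets of the quotient. *)
pose Q C u := normalizer_quotient H C -> B u /\ C = c u.
have [f fP] : {f : set _ -> U & forall C, Q C (f C)}.
  apply: (@boolp.choice _ _ Q) => C.
  have [/csurj[u Bu Cu]|nC] := boolp.EM (normalizer_quotient H C).
    by exists u.
  by exists e => /nC.
exists f; split.
  split.
  - by move=> C /fP[].
  - move=> C D; rewrite !inE => /fP[_ {2}->] /fP[_ {2}->] -> //.
  - move=> u Bu; exists (c u); first exact: cQ.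
    have [Bfu fu] := fP _ (cQ u Bu); exact: cinj.
move=> C D CQ DQ; have [BC CE] := fP C CQ; have [BD DE] := fP D DQ.
have CDE : setwise_mul C D = c (mulU (f C) (f D)) by rewrite {1}CE {1}DE cM.
have [BCD E] := fP _ (cQ _ (BM _ _ BC BD)).
by rewrite CDE; apply: cinj => //; apply: BM.
Qed.

End Complement.

(** * Truncated polynomials *)

Section PolynomialRows.

Variables (F : fieldType) (p : nat).
Implicit Types (q f : {poly F}) (c : nat -> F).

(** The matrix, for row vectors, of the linear endomorphism of F[T]/T^p sending T^a to the class of
    [P a]. *)
Definition poly_rows (P : nat -> {poly F}) : 'M[F]_p := \matrix_(a, b) (P a)`_b.

(* The matrix of multiplication by q on F[T]/T^p, acting on row vectors. *)
Definition toep q : 'M[F]_p := poly_rows (fun a => 'X^a * q).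

(* The matrix of the substitution T := f on F[T]/T^p, acting on row vectors. *)
Definition subst_mx f : 'M[F]_p := poly_rows (fun a => f ^+ a).

(** Truncation does no harm: a coefficient of index b < p in a product involves only coefficients of
    index at most b. *)
Lemma poly_rowsM P q : poly_rows P *m toep q = poly_rows (fun a => P a * q).
Proof.
apply/matrixP => a b; rewrite !mxE coefM.
rewrite (big_ord_widen p (fun j => (P a)`_j * q`_(b - j))) // [RHS]big_mkcond.
apply: eq_bigr => c _; rewrite !mxE coefXnM ltnNge ltnS.
by case: leqP; rewrite ?mulr0.
Qed.

Lemma toepM q f : toep q *m toep f = toep (q * f).
Proof. by rewrite poly_rowsM; apply/matrixP => a b; rewrite !mxE mulrA. Qed.

Lemma toep1 : toep 1 = 1%:M.
Proof. by apply/matrixP => a b; rewrite !mxE mulr1 coefXn eq_sym. Qed.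

Lemma toepC q f : toep q *m toep f = toep f *m toep q.
Proof. by rewrite !toepM mulrC. Qed.

Lemma toepD q f : toep (q + f) = toep q + toep f.
Proof. by apply/matrixP => a b; rewrite !mxE mulrDr coefD. Qed.

Lemma toep_eq q f : (forall k, (k < p)%N -> q`_k = f`_k) -> toep q = toep f.
Proof.
move=> qf; apply/matrixP => a b; rewrite !mxE !coefXnM; case: ltnP => // ab.
by apply: qf; rewrite (leq_ltn_trans (leq_subr _ _)).
Qed.

Lemma poly_XM_drop f : f`_0 = 0 -> f = 'X * drop_poly 1 f.
Proof.
by move=> f0; apply/polyP => -[|k]; rewrite coefXM //= coef_drop_poly addn1.
Qed.

(** Both sides send T^a to f^(a+1): multiplying by T and then substituting f is substituting and
    then multiplying by f. *)
Lemma subst_mxX f : f`_0 = 0 -> toep 'X *m subst_mx f = subst_mx f *m toep f.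
Proof.
move=> f0; rewrite poly_rowsM; apply/matrixP => a b; rewrite !mxE.
under eq_bigr do rewrite !mxE -exprSr coefXn.
have [ap|pa] := ltnP a.+1 p.
  rewrite (bigD1 (Ordinal ap)) //= eqxx mul1r big1 ?addr0 -?exprSr // => i ni.
  by case: eqP => [E|]; rewrite ?mul0r //; case/eqP: ni; apply/val_inj.
(* In the last row the left side is T^p = 0, and the right side f^p vanishes too, being divisible by
   T^p. *)
rewrite big1 => [|i _]; last first.
  case: eqP => [E|]; rewrite ?mul0r //.
  by have := ltn_ord i; rewrite E ltnNge pa.
by rewrite -exprSr (poly_XM_drop f0) exprMn coefXnM (leq_trans (ltn_ord b)).
Qed.

(** Since f^a = T^a (f/T)^a, the matrix is triangular, with the powers f_1^a on its diagonal. *)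
Lemma subst_mx_unit f : f`_0 = 0 -> f`_1 != 0 -> subst_mx f \in unitmx.
Proof.
move=> f0 f1; have fX := poly_XM_drop f0.
rewrite -unitmx_tr unitmxE det_trig; last first.
  by apply/is_trig_mxP => i j ij; rewrite !mxE fX exprMn coefXnM ij.
rewrite unitfE; apply/prodf_neq0 => i _.
rewrite !mxE fX exprMn coefXnM ltnn subnn.
by rewrite -horner_coef0 horner_exp horner_coef0 coef_drop_poly expf_neq0.
Qed.

End PolynomialRows.

(** * Coefficients of powers of truncated series *)

Section Mu.
Variables (F : fieldType).
Implicit Type c : nat -> F.

Lemma coef_exp_eq (f g : {poly F}) i j :
  (forall k, (k <= j)%N -> f`_k = g`_k) -> (f ^+ i)`_j = (g ^+ i)`_j.
Proof.
elim: i j => [|i IH] j fg; first by rewrite !expr0.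
rewrite !exprS !coefM; apply: eq_bigr => k _.
rewrite fg -1?ltnS //; congr (_ * _).
by apply: IH => l lj; apply: fg; apply: leq_trans lj (leq_subr _ _).
Qed.

(** The cut in [mu] depends on j; this lets one polynomial f serve for all the entries of a matrix
    of [W]. *)
Lemma mu_coef c (f : {poly F}) i j :
  f`_0 = 0 -> (forall k, (0 < k <= j)%N -> f`_k = c k) ->
  mu c i j = (f ^+ i)`_j.
Proof.
move=> f0 fc; apply: coef_exp_eq => k kj; rewrite coef_sum.
under eq_bigr do rewrite coefZ coefXn.
case: k kj => [|k] kj.
  by rewrite f0 big_nat big1 // => -[|l] //; rewrite mulr0.
rewrite fc // (bigD1_seq k.+1) ?mem_index_iota ?iota_uniq //= eqxx mulr1.
by rewrite big1 ?addr0 // => l /negPf; rewrite eq_sym => ->; rewrite mulr0.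
Qed.

End Mu.

(** * The centralizer of the block shift *)

Lemma comm_mx_invl (F : fieldType) (n : nat) (A B : 'M[F]_n) :
  A \in unitmx -> comm_mx A B -> comm_mx (invmx A) B.
Proof.
move=> AU AB; apply: (can_inj (mulKmx AU)).
by rewrite mulKVmx // mulmxA AB mulmxK.
Qed.

Lemma conjmxM (F : fieldType) (n : nat) (g A B : 'M[F]_n) : g \in unitmx ->
  g *m A *m invmx g *m (g *m B *m invmx g) = g *m (A *m B) *m invmx g.
Proof. by move=> gU; rewrite !mulmxA mulmxKV. Qed.

Lemma conjmx_eq0 (F : fieldType) (n : nat) (g A : 'M[F]_n) : g \in unitmx ->
  g *m A *m invmx g = 0 -> A = 0.
Proof.
move=> gU /(congr1 (fun Z => invmx g *m Z *m g)).
by rewrite !mulmxA mulVmx // mul1mx mulmxKV // mulmx0 mul0mx.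
Qed.

Lemma mxrank_conj (F : fieldType) (n : nat) (g A B : 'M[F]_n) : g \in unitmx ->
  g *m A = B *m g -> \rank A = \rank B.
Proof.
move=> gU /(congr1 mxrank); rewrite [RHS]mxrankMfree ?row_free_unit // => <-.
rewrite -[RHS]mxrank_tr trmx_mul mxrankMfree ?mxrank_tr //.
by rewrite row_free_unit unitmx_tr.
Qed.

Lemma comm_mx_ratio (F : fieldType) (n : nat) (P g A B : 'M[F]_n) :
  P \in unitmx -> P *m A = B *m P -> g *m A = B *m g ->
  comm_mx (invmx P *m g) A.
Proof.
move=> PU PA gA; apply: (can_inj (mulKmx PU)).
by rewrite -[_ *m A]mulmxA mulKVmx // [RHS]mulmxA PA -mulmxA mulKVmx.
Qed.

(** Elementary matrices are not invertible in general, but the 1 + E_ij are, and commuting with 1 +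
    E_ij amounts to commuting with E_ij. *)
Lemma comm_units_scalar (F : fieldType) (r : nat) (o : 'I_r) (x : 'M[F]_r) :
  2 != 0 :> F -> (forall y, y \in unitmx -> comm_mx x y) ->
  x = (x o o)%:M.
Proof.
move=> F2 xC; have half : 2^-1 + 2^-1 = 1 :> F.
  by rewrite -mulr2n -[LHS]mulr_natl divff.
have dU i j : 1%:M + delta_mx i j \in @unitmx F r.
  (* The inverse is 1 - E_jj / 2 on the diagonal, where 2 != 0 is needed, and 1 - E_ij off it. *)
  have [->|ij] := eqVneq i j.
    apply: (@mulmx1_unit _ _ _ (1%:M - 2^-1 *: delta_mx j j) _).1.
    rewrite mulmxDl mul1mx mulmxBr mulmx1 -scalemxAr mul_delta_mx.
    rewrite -addrA -[RHS]addr0; congr (_ + _); rewrite addrCA -opprD -scalerDl.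
    by rewrite half scale1r subrr.
  apply: (@mulmx1_unit _ _ _ (1%:M - delta_mx i j) _).1.
  rewrite mulmxDl mul1mx mulmxBr mulmx1 mul_delta_mx_0 1?eq_sym //.
  by rewrite subr0 subrK.
have dC i j : x *m delta_mx i j = delta_mx i j *m x.
  have := xC _ (dU i j); rewrite /comm_mx mulmxDl mulmxDr mulmx1 mul1mx.
  by move/addrI.
apply/matrixP => k i; rewrite !mxE.
have /matrixP/(_ k o) := dC i o.
rewrite !mxE (bigD1 i) //= big1 => [|l li]; last first.
  by rewrite mxE (negPf li) mulr0.
rewrite mxE !eqxx mulr1 addr0 => ->.
rewrite (bigD1 o) //= big1 => [|l li]; last first.
  by rewrite mxE (negPf li) andbF mul0r.
by rewrite mxE eqxx andbT addr0 mulr_natl.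
Qed.

Section Block.

Variables (F : fieldType) (r p : nat).
Local Notation size := (\sum_(a < p) r)%N.
Implicit Types (A B g : 'M[F]_size) (G : nat -> nat -> 'M[F]_r).
Implicit Types (h : nat -> 'M[F]_r) (q : {poly F}).

(** The Kronecker product of m with the identity of size r; the block shift and the elements of [W]
    have this form. *)
Definition scal_block (m : 'M[F]_p) : 'M[F]_size :=
  \mxblock_(a < p, b < p) ((m a b)%:M : 'M[F]_r).

Lemma scal_blockM m m' : scal_block m *m scal_block m' = scal_block (m *m m').
Proof.
rewrite mul_mxblock; apply/eq_mxblock => a b; rewrite mxE raddf_sum /=.
by apply: eq_bigr => c _; rewrite scalar_mxM.
Qed.

Lemma scal_block_scalar x : scal_block x%:M = x%:M.
Proof.
rewrite -mxdiagZ; apply/eq_mxblock => a b; rewrite mxE.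
by case: eqVneq => // _; rewrite ?conform_mx_id ?mulr0n ?raddf0.
Qed.

Lemma scal_blockD m m' : scal_block (m + m') = scal_block m + scal_block m'.
Proof. by rewrite -mxblockD; apply/eq_mxblock => a b; rewrite mxE raddfD. Qed.

Lemma scal_block_unit m : m \in unitmx -> scal_block m \in unitmx.
Proof.
move=> mU; apply: (@mulmx1_unit _ _ _ (scal_block (invmx m)) _).1.
by rewrite scal_blockM mulmxV // scal_block_scalar.
Qed.

Lemma scal_block_inv m :
  m \in unitmx -> invmx (scal_block m) = scal_block (invmx m).
Proof.
move=> mU; apply: (can_inj (mulKmx (scal_block_unit mU))).
by rewrite mulmxV ?scal_block_unit // scal_blockM mulmxV // scal_block_scalar.
Qed.

Lemma scal_block0 m : (0 < r)%N -> scal_block m = 0 -> m = 0.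
Proof.
move=> r0 E; apply/matrixP => a b; have := congr1 (fun A => submxblock A a b) E.
rewrite mxblockK submxblock0 mxE.
by move/matrixP/(_ (Ordinal r0) (Ordinal r0)); rewrite !mxE eqxx.
Qed.

Local Notation shift := (scal_block (toep p 'X)).

(** Blocks are indexed by naturals so that neighbouring indices can be written without bounds. *)
Definition nat_block G : 'M[F]_size := \mxblock_(a < p, b < p) G a b.

Lemma nat_blockP A : exists G, A = nat_block G.
Proof.
exists (fun a b => if insub a is Some a' then
   if insub b is Some b' then submxblock A a' b' else 0 else 0).
by rewrite -{1}[A]submxblockK; apply/eq_mxblock => a b; rewrite !valK.
Qed.

Lemma nat_block_shift G : nat_block G *m shift =
  nat_block (fun a b => if b is b'.+1 then G a b' else 0).
Proof.
rewrite mul_mxblock; apply/eq_mxblock => a b.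
under eq_bigr do rewrite mul_mx_scalar mxE -exprSr coefXn.
case: b => [[|b] bp] /=; first by rewrite big1 // => c _; rewrite scale0r.
rewrite (bigD1 (Ordinal (ltnW bp))) //= eqxx scale1r big1 ?addr0 // => c.
by rewrite -val_eqE /= eqSS eq_sym => /negPf->; rewrite scale0r.
Qed.

Lemma shift_nat_block G : shift *m nat_block G =
  nat_block (fun a b => if (a.+1 < p)%N then G a.+1 b else 0).
Proof.
rewrite mul_mxblock; apply/eq_mxblock => a b.
under eq_bigr do rewrite mul_scalar_mx mxE -exprSr coefXn.
case: ltnP => [ap|pa].
  rewrite (bigD1 (Ordinal ap)) //= eqxx scale1r big1 ?addr0 // => c.
  by rewrite -val_eqE /= => /negPf->; rewrite scale0r.
rewrite big1 // => c _; rewrite ltn_eqF ?scale0r //.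
exact: leq_trans (ltn_ord c) pa.
Qed.

(** Commutation says that block (a+1, b+1) equals block (a, b) and that block (a+1, 0) vanishes, so
    the first block row determines A. *)
Lemma comm_shiftP A : comm_mx A shift <-> exists h, A = blockToeplitz p h.
Proof.
split=> [|[h ->]]; last first.
  rewrite /comm_mx (_ : blockToeplitz p h = nat_block (fun a b =>
    if (a <= b)%N then h (b - a)%N else 0)) //.
  rewrite nat_block_shift shift_nat_block; apply/eq_mxblock => a [[|b] bp] /=.
    by case: ifP.
  case: ltnP => ap; first by rewrite ltnS subSS.
  by rewrite leqNgt -ltnS (leq_trans bp ap).
have [G ->] := nat_blockP A; rewrite /comm_mx nat_block_shift shift_nat_block.
rewrite /nat_block => /eq_mxblockP E; exists (G 0); apply/eq_mxblock => a b.
case: a => a /=; elim: a b => [|a IH] b ap; first by rewrite leq0n subn0.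
have := E (Ordinal (ltnW ap)) b; rewrite /= ap => <-.
case: b => [[|b] bp] //=.
by rewrite (IH (Ordinal (ltnW bp))) /= ?subSS // ltnW.
Qed.

(** The right-hand matrix is the value of q at the shift. *)
Lemma comm_toep A q : comm_mx A shift -> comm_mx A (scal_block (toep p q)).
Proof.
move=> AX; elim/poly_ind: q => [|q c IH].
  rewrite (_ : toep p 0 = 0%:M) ?scal_block_scalar; first exact: comm_mx_scalar.
  by apply/matrixP => a b; rewrite !mxE mulr0 coef0 mul0rn.
rewrite toepD -toepM scal_blockD -scal_blockM; apply: comm_mxD.
  exact: comm_mxM.
rewrite (_ : toep p c%:P = c%:M) ?scal_block_scalar.
  exact: comm_mx_scalar.
by apply/matrixP => a b; rewrite !mxE coefMC coefXn eq_sym mulr_natl.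
Qed.

Lemma scal_block_toep q :
  scal_block (toep p q) = blockToeplitz p (fun k => (q`_k)%:M).
Proof.
apply/eq_mxblock => a b; rewrite mxE coefXnM ltnNge.
by case: leqP => //=; rewrite raddf0.
Qed.

(** The matrix is block Toeplitz with scalar blocks; the coefficients of q are read off the first
    row of m. *)
Lemma comm_scal_block m : comm_mx (scal_block m) shift ->
  exists q, scal_block m = scal_block (toep p q).
Proof.
move/comm_shiftP => [h E]; have Eh := E.
rewrite /scal_block /blockToeplitz in Eh; move/eq_mxblockP: Eh => Eh.
have [p0|p0] := posnP p.
  by exists 0; apply/eq_mxblock => a; have := ltn_ord a; rewrite {2}p0.
pose o := Ordinal p0.
exists (\poly_(k < p) (if insub k is Some k' then m o k' else 0)).
rewrite E scal_block_toep; apply/eq_mxblock => a b.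
case: leqP => // ab; have bap : (b - a < p)%N.
  by rewrite (leq_ltn_trans (leq_subr _ _)).
rewrite coef_poly bap (insubT (fun k => k < p)%N bap) /= Eh /= subn0.
by [].
Qed.

Hypothesis p0 : (0 < p)%N.
Local Notation o := (Ordinal p0).

(** Forward substitution: if v is in the left kernel and its blocks before b vanish, then column b
    reads v_b h_0 = 0. *)
Lemma blockToeplitz_unit h : h 0 \in unitmx -> blockToeplitz p h \in unitmx.
Proof.
move=> hU; rewrite -row_free_unit; apply: inj_row_free => v.
have sub0 b : submxrow (0 : 'rV[F]_size) b = 0.
  by apply/matrixP => ? ?; rewrite !mxE.
rewrite -{1}[v]submxrowK mul_mxrow_mxblock => /mxrowP E.
apply/mxrowP => -[b bp]; rewrite sub0.
elim/ltn_ind: b bp => b IH bp; have := E (Ordinal bp).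
rewrite mxrowK sub0 (bigD1 (Ordinal bp)) //= leqnn subnn big1 => [|a ab].
  rewrite addr0 => /(congr1 (mulmx^~ (invmx (h 0)))).
  by rewrite mulmxK // mul0mx.
case: leqP => [ab'|_]; last by rewrite mulmx0.
have lab : (a < b)%N by rewrite ltn_neqAle ab' andbT.
by case: a {ab} ab' lab => a ap ab' lab; rewrite (IH a lab ap) mul0mx.
Qed.

(** Conversely, the inverse of A also commutes with the shift, hence is block Toeplitz; block (0, 0)
    of the product of A and its inverse then shows that h_0 is invertible. *)
Lemma JP A : J A <-> A \in unitmx /\ comm_mx A shift.
Proof.
split=> [[h hU ->]|[AU AX]].
  by split; [apply: blockToeplitz_unit|apply/comm_shiftP; exists h].
have /comm_shiftP[h' E'] := comm_mx_invl AU AX; have /comm_shiftP[h E] := AX.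
exists h => //; have := mulmxV AU; rewrite E' E mul_mxblock -mxdiagZ /mxdiag.
move=> /eq_mxblockP/(_ o o) /=; rewrite conform_mx_id (bigD1 o) //= big1.
  by rewrite addr0 => /mulmx1_unit[].
move=> c; rewrite -val_eqE /= -lt0n => c0; rewrite [(c <= 0)%N]leqNgt c0.
by rewrite mulmx0.
Qed.

Lemma J_subgroup : mx_subgroup (@J F r p).
Proof.
split.
- by move=> A /JP[].
- by apply/JP; rewrite unitmx1; split=> //; apply: comm_scalar_mx.
- move=> A B /JP[AU AX] /JP[BU BX]; apply/JP; rewrite unitmx_mul AU; split=> //.
  by apply/comm_mx_sym/comm_mxM; apply: comm_mx_sym.
- move=> A /JP[AU AX]; apply/JP; rewrite unitmx_inv; split=> //.
  exact: comm_mx_invl.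
Qed.

Lemma J_toep q : q`_0 != 0 -> J (scal_block (toep p q)).
Proof.
move=> q0; rewrite scal_block_toep; exists (fun k => (q`_k)%:M) => //.
by rewrite unitmxE det_scalar unitrX ?unitfE.
Qed.

(** As 1 + X lies in J, with X the shift, A commutes with X and is block Toeplitz; its blocks
    commute with GL(r), hence are scalar. *)
Lemma comm_J_scalar A : 2 != 0 :> F ->
  (forall B, J B -> comm_mx A B) -> exists q, A = scal_block (toep p q).
Proof.
move=> F2 AJ; have /comm_shiftP[h E] : comm_mx A shift.
  have /AJ : J (scal_block (toep p (1 + 'X))).
    by apply: J_toep; rewrite coefD coef1 coefX addr0 oner_eq0.
  rewrite toepD toep1 scal_blockD scal_block_scalar /comm_mx mulmxDl mulmxDr.
  by rewrite mulmx1 mul1mx => /addrI.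
have hC k y : (k < p)%N -> y \in unitmx -> comm_mx (h k) y.
  (* The sequence [y0] gives the matrix of J with y in each diagonal block; block (0, k) of the
     commutation is the claim. *)
  move=> kp yU; pose y0 i := if i is 0%N then y else 0.
  have /AJ : J (blockToeplitz p y0) by exists y0.
  rewrite E /comm_mx !mul_mxblock => /eq_mxblockP/(_ o (Ordinal kp)).
  rewrite (bigD1 (Ordinal kp)) //= big1 => [|c]; last first.
    rewrite -val_eqE /= => ck; case: leqP => ck'; last by rewrite mulmx0.
    case E': (k - c)%N => [|m]; last by rewrite mulmx0.
    by move: ck; rewrite eqn_leq ck' -subn_eq0 E'.
  rewrite leqnn subnn subn0 addr0 => ->.
  rewrite (bigD1 o) //= big1 ?addr0 ?subn0 // => c.
  by rewrite -val_eqE /= subn0; case: (val c) => // k'; rewrite mul0mx.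
have [r0|r0] := posnP r.
  by exists 0; rewrite E; apply/eq_mxblock => a b; apply/matrixP => k;
    have := ltn_ord k; rewrite {2}r0.
pose t := Ordinal r0.
exists (\poly_(k < p) (h k t t)); rewrite scal_block_toep E.
apply/eq_mxblock => a b; case: leqP => // ab.
have bap : (b - a < p)%N by rewrite (leq_ltn_trans (leq_subr _ _)).
by rewrite coef_poly bap; apply: comm_units_scalar => // y; apply: hC.
Qed.

End Block.

(** * The normalizer of J *)

Section BlockNormalizer.

Variables (F : fieldType) (r p : nat).
Local Notation size := (\sum_(a < p) r)%N.
Implicit Types (A B g : 'M[F]_size) (q f : {poly F}).
Local Notation scal := (@scal_block F r p).
Local Notation shift := (scal (toep p 'X)).
Hypothesis p0 : (0 < p)%N.
Local Notation o := (Ordinal p0).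

(** It represents the unit of F[T]/T^p, which every substitution fixes, while an element of J is
    determined by the image of this unit. *)
Definition first_block : 'M[F]_(r, size) :=
  \mxrow_(b < p) ((b == 0 :> nat)%:R%:M : 'M[F]_r).

Lemma first_blockM (B : 'I_p -> 'I_p -> 'M[F]_r) :
  first_block *m \mxblock_(a, b) B a b = \mxrow_b B o b.
Proof.
rewrite mul_mxrow_mxblock; apply/eq_mxrow => b.
rewrite (bigD1 o) //= mul1mx big1 ?addr0 // => a.
by rewrite -val_eqE /= => /negPf->; rewrite raddf0 mul0mx.
Qed.

Lemma J_first_block A : J A -> first_block *m A = first_block -> A = 1%:M.
Proof.
move=> [h _ ->]; rewrite first_blockM /first_block => /eq_mxrowP E.
have hE k : (k < p)%N -> h k = (k == 0%N)%:R%:M.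
  by move=> kp; have := E (Ordinal kp); rewrite /= subn0.
rewrite -scal_block_scalar; apply/eq_mxblock => a b; rewrite mxE.
case: leqP => [ab|ba]; last by rewrite -val_eqE /= gtn_eqF // raddf0.
rewrite hE ?(leq_ltn_trans (leq_subr _ _)) // -val_eqE /=.
by rewrite subn_eq0 eqn_leq ab.
Qed.

Lemma WE A : W A <->
  exists f, [/\ f`_0 = 0, f`_1 != 0 & A = scal (subst_mx p f)].
Proof.
split=> [[c c1 ->]|[f [f0 f1 ->]]].
  (* The coefficients c_1, ..., c_p are kept, one more than the matrix sees, so that f_1 = c_1 != 0
     even for p = 1. *)
  exists ('X * \poly_(k < p) c k.+1).
  rewrite !coefXM /= coef_poly p0; split=> //; apply/eq_mxblock => i j.
  rewrite mxE; congr _%:M; apply: mu_coef; first by rewrite coefXM.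
  move=> [|k] //= kj; rewrite coefXM coef_poly /= ifT //.
  exact: ltn_trans (ltn_ord j).
exists (fun k => f`_k) => //; apply/eq_mxblock => i j.
by rewrite mxE; congr _%:M; apply/esym/mu_coef.
Qed.

Lemma W_first_block A : W A -> first_block *m A = first_block.
Proof.
move=> /WE[f [_ _ ->]]; rewrite first_blockM; apply/eq_mxrow => b.
by rewrite mxE expr0 coef1.
Qed.

(** Conjugating an element B of J by the substitution matrix M preserves J if B commutes with M^-1 X
    M and M X M^-1, X being the shift. The former is f(X). *)
Lemma W_normalizer A : W A -> GL_normalizer (@J F r p) A.
Proof.
move=> /WE[f [f0 f1 ->]]; set m := subst_mx p f.
have mU : m \in unitmx by apply: subst_mx_unit.
have MU : scal m \in unitmx by apply: scal_block_unit.
have XM : shift *m scal m = scal m *m scal (toep p f).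
  by rewrite !scal_blockM subst_mxX.
apply/GL_normalizerP; split=> // B /(JP p0)[BU BX].
split; apply/(JP p0); rewrite !unitmx_mul unitmx_inv MU BU; split=> //.
  have /(congr1 (mulmx^~ (invmx (scal m)))) := XM; rewrite mulmxK // => XE.
  rewrite /comm_mx XE !mulmxA mulmxKV //.
  by rewrite -[scal m *m B *m _]mulmxA (comm_toep f BX) !mulmxA mulmxKV.
(* No compositional inverse of f is computed: conjugating the commutation of f(X) = m^-1 X m with X
   shows that m X m^-1 commutes with X, hence is a polynomial in X. *)
pose b := m *m toep p 'X *m invmx m.
have bE : scal b = scal m *m shift *m invmx (scal m).
  by rewrite scal_block_inv // !scal_blockM.
have [q bq] : exists q, scal b = scal (toep p q).
  apply: comm_scal_block; rewrite /comm_mx !scal_blockM; congr scal.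
  have toep_f : toep p f = invmx m *m toep p 'X *m m.
    by rewrite -mulmxA subst_mxX // mulKmx.
  have := toepC p f 'X; rewrite toep_f.
  move/(congr1 (fun Z => m *m Z *m invmx m)).
  by rewrite /b !mulmxA mulmxV // mul1mx mulmxK.
have := comm_toep q BX; rewrite -bq bE.
move/(congr1 (fun Z => invmx (scal m) *m Z *m scal m)).
by rewrite /comm_mx !mulmxA mulmxKV // mulVmx // mul1mx.
Qed.

Lemma normalizer_J g : (0 < r)%N -> 2 != 0 :> F -> GL_normalizer (@J F r p) g ->
  exists2 w, W w & exists2 h, J h & g = w *m h.
Proof.
move=> r0 F2 gN; have /GL_normalizerP[gU gJ] := gN.
have [q qE] : exists q, invmx g *m shift *m g = scal (toep p q).
  apply: comm_J_scalar => // B BJ; have [/(JP p0)[_ gB] _] := gJ B BJ.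
  move/(congr1 (fun Z => invmx g *m Z *m g)): gB.
  by rewrite /comm_mx !mulmxA mulmxKV // mulVmx // mul1mx.
have Xg : shift *m g = g *m scal (toep p q).
  by rewrite -qE !mulmxA mulmxV // mul1mx.
have Xng k : scal (toep p ('X ^+ k)) *m g = g *m scal (toep p (q ^+ k)).
  elim: k => [|k IH].
    by rewrite !expr0 toep1 scal_block_scalar mulmx1 mul1mx.
  by rewrite !exprSr -!toepM -!scal_blockM -mulmxA Xg mulmxA IH !mulmxA.
(* Since g conjugates X^k to q(X)^k, both vanish together; the nilpotency order p of X yields q_0 =
   0 and q_1 != 0. *)
have Xn0 k f : scal (toep p ('X ^+ k)) *m g = g *m scal (toep p f) ->
    toep p 'X^k = 0 :> 'M[F]_p <-> toep p f = 0.
  move=> E; have scal0 : scal 0 = 0.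
    by rewrite -mxblock0; apply/eq_mxblock => a b; rewrite mxE raddf0.
  split=> Z; apply: (scal_block0 r0); move: E; rewrite Z scal0.
    by rewrite mul0mx => /(congr1 (mulmx (invmx g))); rewrite mulKmx // mulmx0.
  by rewrite mulmx0 => /(congr1 (mulmx^~ (invmx g))); rewrite mulmxK // mul0mx.
have toep0 f : toep p f = 0 -> f`_0 = 0.
  by move/matrixP/(_ o o); rewrite !mxE expr0 mul1r.
have toepXn k f : (p <= k)%N -> toep p ('X^k * f) = 0.
  move=> pk; apply/matrixP => a b; rewrite !mxE mulrCA coefXnM.
  by rewrite (leq_trans (ltn_ord b)).
have q0 : q`_0 = 0.
  have /toep0 : toep p (q ^+ p) = 0.
    by apply/(Xn0 p _ (Xng p)); rewrite -['X^p]mulr1 toepXn.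
  by rewrite -!horner_coef0 hornerE => /eqP; rewrite expf_eq0 => /andP[_ /eqP].
have q1 : (1 < p)%N -> q`_1 != 0.
  move=> p1; apply/eqP => q1; have qX : q = 'X^2 * drop_poly 2 q.
    by apply/polyP => -[|[|k]]; rewrite coefXnM //= coef_drop_poly subn2 addn2.
  (* If T^2 divides q, then q^(p-1) is divisible by T^(2p-2), and 2p - 2 >= p as p > 1. *)
  have /(Xn0 _ _ (Xng p.-1)).2 : toep p (q ^+ p.-1) = 0.
    rewrite qX exprMn -exprM toepXn // -(ltn_predK p1) /= mul2n -addnn.
    by rewrite -addn1 leq_add2l -ltnS (ltn_predK p1).
  have p1p : (p.-1 < p)%N by rewrite ltn_predL.
  move/matrixP/(_ o (Ordinal p1p))/eqP.
  by rewrite !mxE expr0 mul1r coefXn eqxx oner_eq0.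
(* For p = 1 nothing is known of q_1, but then only the constant term matters and T can replace
   q. *)
pose f := if (1 < p)%N then q else 'X.
have f0 : f`_0 = 0 by rewrite /f; case: ifP => // _; rewrite coefX.
have f1 : f`_1 != 0.
  by rewrite /f; case: ifP => // _; rewrite coefX oner_eq0.
have fq : toep p f = toep p q.
  apply: toep_eq => k kp; rewrite /f; case: ifP => // /negbT.
  rewrite -leqNgt => p1.
  by have := leq_trans kp p1; case: k {kp} => // _; rewrite coefX.
set M := scal (subst_mx p f).
have MW : W M by apply/WE; exists f.
have MU : M \in unitmx by apply/scal_block_unit/subst_mx_unit.
have XM : shift *m M = M *m scal (toep p q).
  by rewrite -fq !scal_blockM subst_mxX.
exists M => //; exists (invmx M *m g); last by rewrite mulKVmx.
(* With this order of the factors the product commutes with the shift; conjugation by M, which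
   normalizes J, then puts M^-1 g in J. *)
have gMJ : J (g *m invmx M).
  apply/(JP p0); rewrite unitmx_mul gU unitmx_inv; split=> //.
  rewrite /comm_mx mulmxA Xg -!mulmxA; congr (g *m _).
  apply: (can_inj (mulmxK MU)); rewrite !mulmxKV // -mulmxA XM.
  by rewrite mulmxA mulVmx // mul1mx.
have /GL_normalizerP[_ /(_ _ gMJ)[_]] := W_normalizer MW.
by rewrite mulmxA mulmxKV.
Qed.

Lemma W_J A : W A -> J A -> A = 1%:M.
Proof. by move=> /W_first_block WA JA; apply: J_first_block. Qed.

(* W is the stabilizer of the first block row in the normalizer of J, which
   makes it visibly a group. *)
Lemma WP A : (0 < r)%N -> 2 != 0 :> F ->
  W A <-> GL_normalizer (@J F r p) A /\ first_block *m A = first_block.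
Proof.
move=> r0 F2; split=> [WA|[AN A1]].
  by split; [apply: W_normalizer|apply: W_first_block].
have [w Ww [h Jh AE]] := normalizer_J r0 F2 AN.
suff h1 : h = 1%:M by rewrite AE h1 mulmx1.
by apply: J_first_block => //; rewrite -{1}(W_first_block Ww) -mulmxA -AE.
Qed.

Lemma W_subgroup : (0 < r)%N -> 2 != 0 :> F -> mx_subgroup (@W F r p).
Proof.
move=> r0 F2; have NG := GL_normalizer_subgroup (@J F r p).
split.
- by move=> A /W_normalizer[].
- by apply/WP => //; split; [apply: (mxsub1 NG)|rewrite mulmx1].
- move=> A B /WP[] // AN A1 /WP[] // BN B1; apply/WP => //.
  by split; [apply: (mxsubM NG)|rewrite mulmxA A1].
- move=> A /WP[] // AN A1; apply/WP => //.
  by split; [apply: (mxsubV NG)|rewrite -{1}A1 mulmxK; case: AN].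
Qed.

End BlockNormalizer.

(** * Block diagonal matrices and block permutations *)

Section Diagonal.

Variables (F : fieldType) (n : nat) (q_ : 'I_n -> nat).
Local Notation size := (\sum_i q_ i)%N.
Implicit Types (X Y : forall i, 'M[F]_(q_ i)) (H : forall i, set 'M[F]_(q_ i)).

Definition mxdiag_set H : set 'M[F]_size :=
  [set A | exists2 Y, forall i, H i (Y i) & A = \mxdiag_i Y i].

Lemma mul_mxdiag X Y : \mxdiag_i X i *m \mxdiag_i Y i = \mxdiag_i (X i *m Y i).
Proof.
rewrite {2}/mxdiag mul_mxdiag_mxblock; apply/eq_mxblock => i j.
by case: eqVneq => [->|_]; rewrite ?conform_mx_id ?mulmx0.
Qed.

Lemma comm_mxdiag X Y : (forall i, comm_mx (X i) (Y i)) ->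
  comm_mx (\mxdiag_i X i) (\mxdiag_i Y i).
Proof.
by move=> XY; rewrite /comm_mx !mul_mxdiag; apply/eq_mxdiag => i; apply: XY.
Qed.

Lemma mxdiag_unit X : (forall i, X i \in unitmx) -> \mxdiag_i X i \in unitmx.
Proof.
move=> XU; apply: (@mulmx1_unit _ _ _ (\mxdiag_i invmx (X i)) _).1.
by rewrite mul_mxdiag -mxdiagZ; apply/eq_mxdiag => i; rewrite mulmxV.
Qed.

Lemma mxdiag_inv X : (forall i, X i \in unitmx) ->
  invmx (\mxdiag_i X i) = \mxdiag_i invmx (X i).
Proof.
move=> XU; apply: (can_inj (mulKmx (mxdiag_unit XU))).
rewrite mulmxV ?mxdiag_unit // mul_mxdiag -mxdiagZ.
by apply/eq_mxdiag => i; rewrite mulmxV.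
Qed.

(** The rank is the sum of the ranks of the blocks, so full rank forces each block to have full
    rank. *)
Lemma mxdiag_unitV X i : \mxdiag_i X i \in unitmx -> X i \in unitmx.
Proof.
move=> /mxrank_unit; rewrite rank_mxdiag => E; rewrite -row_free_unit.
have le_i : (\sum_(j | j != i) \rank (X j) <= \sum_(j | j != i) q_ j)%N.
  by apply: leq_sum => j _; apply: rank_leq_row.
move: E; rewrite (bigD1 i) //= [RHS](bigD1 i) //= => E.
rewrite /row_free eqn_leq rank_leq_row /=.
by rewrite -(leq_add2r (\sum_(j | j != i) \rank (X j))) E leq_add2l.
Qed.

Lemma mxdiag_subgroup H :
  (forall i, mx_subgroup (H i)) -> mx_subgroup (mxdiag_set H).
Proof.
move=> HG; split.
- by move=> _ [X XH ->]; apply: mxdiag_unit => i; apply: (mxsub_unit (HG i)).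
- by exists (fun=> 1%:M) => [i|]; [apply: (mxsub1 (HG i))|rewrite mxdiagZ].
- move=> _ _ [X XH ->] [Y YH ->]; rewrite mul_mxdiag.
  by exists (fun i => X i *m Y i) => // i; apply: (mxsubM (HG i)).
- move=> _ [X XH ->]; exists (fun i => invmx (X i)).
    by move=> i; apply: (mxsubV (HG i)).
  by rewrite mxdiag_inv // => i; apply: (mxsub_unit (HG i)).
Qed.

Lemma mxdiag_normalizer H X : (forall i, GL_normalizer (H i) (X i)) ->
  GL_normalizer (mxdiag_set H) (\mxdiag_i X i).
Proof.
move=> XN; have XU i : X i \in unitmx by have [] := XN i.
have {}XN i h : H i h -> _ := ((GL_normalizerP _ _).1 (XN i)).2 h.
apply/GL_normalizerP; split; first exact: mxdiag_unit.
move=> _ [Y YH ->]; rewrite mxdiag_inv // !mul_mxdiag.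
split; [exists (fun i => X i *m Y i *m invmx (X i)) => // i
       |exists (fun i => invmx (X i) *m Y i *m X i) => // i];
  by have [] := XN _ _ (YH i).
Qed.

(** The embedding of the factor i in the product, used to test a property of the product on one
    factor. *)
Definition unit_but i (h : 'M[F]_(q_ i)) : forall j, 'M[F]_(q_ j) :=
  @dfwith 'I_n (fun j => 'M[F]_(q_ j)) (fun j => 1%:M) i h.

Lemma unit_but_in H i (h : 'M[F]_(q_ i)) : (forall j, H j 1%:M) -> H i h ->
  mxdiag_set H (\mxdiag_j unit_but h j).
Proof.
move=> H1 Hh; exists (unit_but h) => // j; rewrite /unit_but.
by case: dfwithP => // k _; apply: H1.
Qed.

Lemma unit_butE i (h : 'M[F]_(q_ i)) : unit_but h i = h.
Proof. exact: dfwith_in. Qed.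

Lemma mxdiag_setP H X i : mxdiag_set H (\mxdiag_i X i) -> H i (X i).
Proof. by move=> [Y YH /eq_mxdiagP ->]. Qed.

Lemma mxdiag_normalizerV H X i : (forall j, H j 1%:M) ->
  GL_normalizer (mxdiag_set H) (\mxdiag_i X i) -> GL_normalizer (H i) (X i).
Proof.
move=> H1 /GL_normalizerP[XU XN].
have XiU j : X j \in unitmx := mxdiag_unitV j XU.
apply/GL_normalizerP; split=> // h Hh.
have [] := XN _ (unit_but_in H1 Hh); rewrite mxdiag_inv // !mul_mxdiag.
by move=> /(@mxdiag_setP _ _ i) + /(@mxdiag_setP _ _ i); rewrite !unit_butE.
Qed.

Lemma mxdiag_comm H X i h : (forall j, H j 1%:M) -> H i h ->
  (forall A, mxdiag_set H A -> comm_mx (\mxdiag_i X i) A) -> comm_mx (X i) h.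
Proof.
move=> H1 Hh XC; have := XC _ (unit_but_in H1 Hh).
rewrite /comm_mx !mul_mxdiag => /eq_mxdiagP/(_ i).
by rewrite unit_butE.
Qed.

Definition diag_idem i0 : 'M[F]_size := \mxdiag_i (i == i0)%:R%:M.

Lemma comm_diag_idem (A : 'M[F]_size) : (forall i, comm_mx A (diag_idem i)) ->
  A = \mxdiag_i (submxblock A i i).
Proof.
move=> AC; rewrite -{1}[A]submxblockK; apply/eq_mxblock => i j.
case: eqVneq => [->|ij]; first by rewrite conform_mx_id.
have := AC j; rewrite /comm_mx -{1 2}[A]submxblockK.
rewrite mul_mxblock_mxdiag mul_mxdiag_mxblock => /eq_mxblockP/(_ i j).
by rewrite eqxx (negPf ij) mulmx1 raddf0 mul0mx.
Qed.

End Diagonal.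

(** * Block permutation matrices *)

Section BlockPermutations.

Variables (F : fieldType) (d p : nat).
Implicit Types (s t : 'S_p) (X : 'I_p -> 'M[F]_d).
Local Notation bp := (@block_perm_mx F d p).

(** The order is reversed because permutations multiply from left to right: [t * s] applies t
    first. *)
Lemma block_perm_mxM s t : bp s *m bp t = bp (t * s)%g.
Proof.
rewrite mul_mxblock; apply/eq_mxblock => j k; rewrite permM.
rewrite (bigD1 (t k)) //= eqxx mulmx1 big1 ?addr0 // => c /negPf->.
by rewrite raddf0 mulmx0.
Qed.

Lemma block_perm_mx1 : bp 1%g = 1%:M.
Proof.
rewrite -mxdiagZ; apply/eq_mxblock => j k; rewrite perm1.
by case: eqVneq => // _; rewrite ?conform_mx_id ?raddf0.
Qed.

Lemma block_perm_unit s : bp s \in unitmx.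
Proof.
apply: (@mulmx1_unit _ _ _ (bp s^-1%g) _).1.
by rewrite block_perm_mxM mulVg block_perm_mx1.
Qed.

Lemma block_perm_inv s : invmx (bp s) = bp s^-1%g.
Proof.
apply: (can_inj (mulKmx (block_perm_unit s))).
by rewrite mulmxV ?block_perm_unit // block_perm_mxM mulVg block_perm_mx1.
Qed.

Lemma block_perm_diag s X :
  bp s *m \mxdiag_k X k = \mxdiag_k X (s^-1%g k) *m bp s.
Proof.
rewrite mul_mxblock_mxdiag mul_mxdiag_mxblock; apply/eq_mxblock => j k.
case: eqVneq => [->|_]; first by rewrite permK mulmx1 mul1mx.
by rewrite raddf0 mulmx0 mul0mx.
Qed.

Lemma block_perm_normalizer (H : set 'M[F]_d) s :
  GL_normalizer (mxdiag_set (fun _ : 'I_p => H)) (bp s).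
Proof.
apply/GL_normalizerP; split; first exact: block_perm_unit.
move=> _ [X XH ->]; split.
  rewrite block_perm_diag mulmxK ?block_perm_unit //.
  by exists (fun k => X (s^-1%g k)).
rewrite block_perm_inv block_perm_diag -block_perm_inv.
rewrite mulmxKV ?block_perm_unit //.
by exists (fun k => X ((s^-1)^-1%g k)).
Qed.

Lemma block_perm_mxdiag s X : (0 < d)%N -> bp s = \mxdiag_k X k -> s = 1%g.
Proof.
move=> d0; rewrite /block_perm_mx /mxdiag => /eq_mxblockP E.
apply/permP => k; rewrite perm1; apply/eqP; apply: contraT => sk.
have := E (s k) k; rewrite eqxx (negPf sk).
move=> /matrixP/(_ (Ordinal d0) (Ordinal d0)); rewrite !mxE eqxx => /eqP.
by rewrite oner_eq0.
Qed.

End BlockPermutations.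

(** * The normalizer of a product of groups J *)

Section Wreath.

Variables (F : fieldType) (r n p : nat).
Hypotheses (r0 : (0 < r)%N) (n0 : (0 < n)%N) (F2 : 2 != 0 :> F).
Local Notation d := (\sum_(a < n) r)%N.
Local Notation bp := (@block_perm_mx F d p).
Local Notation Wr := (@W_wreath F r n p).

Lemma block_size_gt0 : (0 < d)%N.
Proof. by rewrite sum_nat_const card_ord muln_gt0 n0. Qed.

Lemma W_wreathP A : Wr A <->
  exists X s, (forall k, W (X k)) /\ A = \mxdiag_(k < p) X k *m bp s.
Proof.
split=> [[_ [X XW ->] [_ [s _ <-] <-]]|[X [s [XW ->]]]]; first by exists X, s.
exists (\mxdiag_k X k); first by exists X.
by exists (bp s) => //; exists s.
Qed.

Lemma W_wreath_subgroup : mx_subgroup Wr.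
Proof.
have WG := W_subgroup n0 r0 F2; split.
- move=> _ /W_wreathP[X [s [XW ->]]]; rewrite unitmx_mul block_perm_unit andbT.
  by apply: mxdiag_unit => k; apply: (mxsub_unit WG).
- apply/W_wreathP; exists (fun=> 1%:M), 1%g; split.
    by move=> _; apply: (mxsub1 WG).
  by rewrite mxdiagZ block_perm_mx1 mulmx1.
- move=> _ _ /W_wreathP[X [s [XW ->]]] /W_wreathP[Y [t [YW ->]]].
  (* Moving the permutation s to the right across diag(Y) reindexes the blocks by s^-1. *)
  apply/W_wreathP; exists (fun k => X k *m Y (s^-1%g k)), (t * s)%g; split.
    by move=> k; apply: (mxsubM WG).
  rewrite -mul_mxdiag -block_perm_mxM !mulmxA; congr (_ *m _).
  by rewrite -!mulmxA block_perm_diag.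
- move=> _ /W_wreathP[X [s [XW ->]]].
  have XU k : X k \in unitmx by apply: (mxsub_unit WG).
  rewrite invmxM ?block_perm_unit ?mxdiag_unit // mxdiag_inv // block_perm_inv.
  rewrite block_perm_diag; apply/W_wreathP.
  exists (fun k => invmx (X (s^-1^-1%g k))), s^-1%g; split=> // k.
  exact: (mxsubV WG).
Qed.

Lemma W_wreath_normalizer A :
  Wr A -> GL_normalizer (mxdiag_set (fun _ : 'I_p => @J F r n)) A.
Proof.
move=> /W_wreathP[X [s [XW ->]]].
apply: (mxsubM (GL_normalizer_subgroup _)); last exact: block_perm_normalizer.
by apply: mxdiag_normalizer => k; apply: W_normalizer.
Qed.

(** If diag(X) P_s = diag(Y), then P_s is block diagonal, so s = 1, and each X_k lies in both [W]
    and [J]. *)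
Lemma W_wreath_J A :
  Wr A -> mxdiag_set (fun _ : 'I_p => @J F r n) A -> A = 1%:M.
Proof.
move=> /W_wreathP[X [s [XW ->]]] [Y YJ E].
have XU k : X k \in unitmx by apply: (mxsub_unit (W_subgroup n0 r0 F2)).
have s1 : s = 1%g.
  apply: (@block_perm_mxdiag F d p s (fun k => invmx (X k) *m Y k)).
    exact: block_size_gt0.
  by rewrite -mul_mxdiag -mxdiag_inv // -E mulKmx ?mxdiag_unit.
move: E; rewrite s1 block_perm_mx1 mulmx1 => /eq_mxdiagP E.
rewrite -mxdiagZ; apply/eq_mxdiag => k; apply: (W_J n0) => //.
by rewrite E.
Qed.

End Wreath.

(* F[T]/T^n is local, so that its only idempotents are 0 and 1. *)
Lemma toep_idempotent (F : fieldType) (r n : nat) (q : {poly F}) :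
    (0 < r)%N -> (0 < n)%N ->
    let S := scal_block r (toep n q) in S *m S = S ->
  exists b : bool, scal_block r (toep n q) = b%:R%:M.
Proof.
(* An invertible idempotent is 1. This applies to S if q_0 != 0, and to 1 - S otherwise. *)
move=> r0 n0 S; have unit1 (f : {poly F}) : f`_0 != 0 ->
    let S := scal_block r (toep n f) in S *m S = S -> S = 1%:M.
  move=> f0 /=; have /(JP n0)[SU _] := J_toep r n f0.
  move/(congr1 (mulmx (invmx (scal_block r (toep n f))))).
  by rewrite mulKmx // mulVmx.
have SC : scal_block r (toep n (1 - q)) = 1%:M - S.
  apply/eqP; rewrite eq_sym subr_eq -scal_blockD -toepD subrK toep1.
  by rewrite scal_block_scalar.
move=> SS; have [q0|q0] := eqVneq q`_0 0; last by exists true; apply: unit1.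
exists false; rewrite raddf0; have : 1%:M - S = 1%:M.
  rewrite -SC; apply: unit1; first by rewrite coefB coef1 q0 subr0 oner_eq0.
  by rewrite SC mulmxBl mul1mx mulmxBr mulmx1 SS subrr subr0.
by move/eqP; rewrite subr_eq -subr_eq0 opprD addrA subrr sub0r oppr_eq0 => /eqP.
Qed.

(** * Block idempotents and the normalizer of the full product *)

Section Normalizer.

Variables (F : fieldType) (s r : nat) (n_ p_ : 'I_s -> nat).
Hypotheses (r0 : (0 < r)%N) (n0 : forall i, (0 < n_ i)%N) (F2 : 2 != 0 :> F).
Hypothesis n_inj : injective n_.
Local Notation d i := (\sum_(a < n_ i) r)%N.
Local Notation size := (\sum_i \sum_(k < p_ i) d i)%N.
Local Notation L := {i : 'I_s & 'I_(p_ i)}.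
Local Notation lab k := (Tagged (fun i => 'I_(p_ i)) k).
Implicit Types (b : L -> F) (l m : L) (A g : 'M[F]_size).

Definition J_diag i : set 'M[F]_(\sum_(k < p_ i) d i) :=
  mxdiag_set (fun _ : 'I_(p_ i) => @J F r (n_ i)).

Definition J_product : set 'M[F]_size := mxdiag_set (@J_diag).

Lemma J_diag_subgroup i : mx_subgroup (@J_diag i).
Proof. by apply: mxdiag_subgroup => k; apply: J_subgroup. Qed.

Lemma J_product_subgroup : mx_subgroup J_product.
Proof. exact: mxdiag_subgroup J_diag_subgroup. Qed.

(** The algebra of functions on the set [L] of block labels, realized by diagonal matrices; the
    block idempotents are the indicator functions of points. *)
Definition block_scal b : 'M[F]_size :=
  \mxdiag_i \mxdiag_(k < p_ i) ((b (lab k))%:M : 'M[F]_(d i)).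

Lemma block_scalM b c :
  block_scal b *m block_scal c = block_scal (fun l => b l * c l).
Proof.
rewrite mul_mxdiag; apply/eq_mxdiag => i; rewrite mul_mxdiag.
by apply/eq_mxdiag => k; rewrite scalar_mxM.
Qed.

Lemma block_scalD b c :
  block_scal b + block_scal c = block_scal (fun l => b l + c l).
Proof.
rewrite -mxdiagD; apply/eq_mxdiag => i; rewrite -mxdiagD.
by apply/eq_mxdiag => k; rewrite raddfD.
Qed.

Lemma block_scalar x : block_scal (fun=> x) = x%:M.
Proof. by rewrite -mxdiagZ; apply/eq_mxdiag => i; rewrite mxdiagZ. Qed.

Lemma block_scal0 : block_scal (fun=> 0) = 0.
Proof. by rewrite block_scalar raddf0. Qed.

Lemma block_scal_inj b c : block_scal b = block_scal c -> b =1 c.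
Proof.
rewrite /block_scal => /eq_mxdiagP E [i k]; have /eq_mxdiagP/(_ k) := E i.
have d0 := block_size_gt0 r0 (n0 i).
by move/matrixP/(_ (Ordinal d0) (Ordinal d0)); rewrite !mxE eqxx !mulr1n.
Qed.

Lemma comm_block_scal b (X : forall i, 'I_(p_ i) -> 'M[F]_(d i)) :
  comm_mx (block_scal b) (\mxdiag_i \mxdiag_k X i k).
Proof.
apply: comm_mxdiag => i; apply: comm_mxdiag => k.
exact: comm_scalar_mx.
Qed.

Lemma J_productP A : J_product A <->
  exists2 X : forall i, 'I_(p_ i) -> 'M[F]_(d i),
    forall i k, J (X i k) & A = \mxdiag_i \mxdiag_k X i k.
Proof.
split=> [[Y YJ ->]|[X XJ ->]]; last first.
  by exists (fun i => \mxdiag_k X i k) => // i; exists (X i).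
have [X XJ XE] := fin_all_exists2 YJ.
by exists X; first by []; apply/eq_mxdiag => i; apply: XE.
Qed.

Definition idem l : 'M[F]_size := block_scal (fun m => (m == l)%:R).

(** An idempotent need not be invertible, but adding 1 makes it so as 2 != 0, without changing what
    commutes with it. *)
Lemma idem_J l : J_product (1%:M + idem l).
Proof.
rewrite -block_scalar block_scalD; apply/J_productP.
exists (fun i k => (1 + (lab k == l)%:R)%:M) => // i k.
apply/(JP (n0 i)); split; last exact: comm_scalar_mx.
rewrite unitmxE det_scalar unitfE expf_neq0 //.
by case: (_ == l); rewrite //= addr0 oner_eq0.
Qed.

Lemma block_scal_sum b : block_scal b = \sum_l (b l)%:M *m idem l.
Proof.
under [RHS]eq_bigr do rewrite -block_scalar block_scalM.
rewrite /block_scal -mxdiag_sum; apply/eq_mxdiag => i; rewrite -mxdiag_sum.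
apply/eq_mxdiag => k; rewrite (bigD1 (lab k)) //= eqxx mulr1.
rewrite [X in _ + X]big1 ?addr0 // => l.
by rewrite eq_sym => /negPf->; rewrite mulr0 raddf0.
Qed.

Lemma comm_idem_scal A b :
  (forall l, comm_mx A (idem l)) -> comm_mx A (block_scal b).
Proof.
move=> AC; rewrite block_scal_sum; apply: comm_mx_sum => l _.
by apply: comm_mxM => //; apply: comm_mx_scalar.
Qed.

(** Sums of block idempotents over one value of the tag give the outer block structure; single ones
    then split each outer block. *)
Lemma comm_idemP A : (forall l, comm_mx A (idem l)) ->
  A = \mxdiag_i \mxdiag_k submxblock (submxblock A i i) k k.
Proof.
move=> AC; have AE : A = \mxdiag_i submxblock A i i.
  apply: comm_diag_idem => i.
  suff -> : diag_idem F _ i = block_scal (fun l => (tag l == i)%:R).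
    exact: comm_idem_scal.
  by apply/eq_mxdiag => j; rewrite mxdiagZ.
rewrite {1}AE; apply/eq_mxdiag => i; apply: comm_diag_idem => k.
have := AC (lab k); rewrite {1}AE /comm_mx !mul_mxdiag => /eq_mxdiagP/(_ i).
rewrite (_ : \mxdiag__ _ = diag_idem _ _ k) //.
by apply/eq_mxdiag => k'; rewrite eq_Tagged.
Qed.

Lemma comm_J_productP A : (forall B, J_product B -> comm_mx A B) ->
  exists q : forall i, 'I_(p_ i) -> {poly F},
    A = \mxdiag_i \mxdiag_k scal_block r (toep (n_ i) (q i k)).
Proof.
move=> AJ; have AI l : comm_mx A (idem l).
  have := AJ _ (idem_J l); rewrite /comm_mx mulmxDl mulmxDr mul1mx mulmx1.
  by move/addrI.
have AE := comm_idemP AI; set X := fun i => _ in AE.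
have qP i k : exists q : {poly F},
    submxblock (submxblock A i i) k k = scal_block r (toep (n_ i) q).
  apply: (comm_J_scalar (n0 i) F2) => B BJ.
  have J1 j := mxsub1 (J_diag_subgroup j).
  pose Bi : 'M[F]_(\sum_(k < p_ i) d i) :=
    \mxdiag_k' unit_but (q_ := fun=> d i) (i := k) B k'.
  have BiJ : J_diag Bi.
    apply: (@unit_but_in _ _ _ (fun=> @J F r (n_ i))) => // k'.
    exact: mxsub1 (J_subgroup _ _ _).
  rewrite AE in AJ; have := mxdiag_comm J1 BiJ AJ; rewrite /Bi.
  by rewrite /comm_mx !mul_mxdiag => /eq_mxdiagP/(_ k); rewrite unit_butE.
have [q qE] := fin_all_exists (fun i => fin_all_exists (qP i)).
by exists q; rewrite {1}AE; apply/eq_mxdiag => i; apply/eq_mxdiag => k.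
Qed.

Lemma idemM l m : idem l *m idem m = if l == m then idem l else 0.
Proof.
rewrite block_scalM; case: eqVneq => [->|lm].
  apply/eq_mxdiag => i; apply/eq_mxdiag => k.
  by case: (_ == m); rewrite ?mulr1 ?mulr0.
rewrite -block_scal0; apply/eq_mxdiag => i; apply/eq_mxdiag => k.
by case: eqVneq => [->|_]; rewrite ?(negPf lm) ?mulr0 ?mul0r.
Qed.

(** The conjugate still commutes with [J_product], which g normalizes, so it is an idempotent of a
    product of rings F[T]/T^(n_i), each with no idempotents but 0 and 1. *)
Lemma conj_idem g l : GL_normalizer J_product g ->
  exists b : L -> bool, g *m idem l *m invmx g = block_scal (fun m => (b m)%:R).
Proof.
move=> /GL_normalizerP[gU gN]; set A := g *m _ *m _.
have AA : A *m A = A.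
  by rewrite /A conjmxM // idemM eqxx.
have [B /gN[_ gB]|q E] := @comm_J_productP A.
  have /J_productP[X _ XE] := gB.
  have := comm_block_scal (fun m => (m == l)%:R) X.
  rewrite -XE => /(congr1 (fun Z => g *m Z *m invmx g)).
  by rewrite /comm_mx /A !mulmxA mulmxV // mul1mx mulmxK // mulmxKV.
have bE i k : exists b : bool, scal_block r (toep (n_ i) (q i k)) = b%:R%:M.
  apply: toep_idempotent => //; move: AA; rewrite E !mul_mxdiag.
  by move=> /eq_mxdiagP/(_ i); rewrite mul_mxdiag => /eq_mxdiagP/(_ k).
have [b {}bE] := fin_all_exists (fun i => fin_all_exists (bE i)).
exists (fun m => b (tag m) (tagged m)); rewrite E.
by apply/eq_mxdiag => i; apply/eq_mxdiag => k.
Qed.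

(** The conjugates are nonzero and pairwise orthogonal, so their supports [b l] are nonempty
    disjoint subsets of [L]. As there are as many of them as labels, each is a single point. *)
Lemma conj_idem_perm g : GL_normalizer J_product g ->
  exists2 f : L -> L, injective f & forall l, g *m idem l = idem (f l) *m g.
Proof.
move=> gN; have [b bE] := fin_all_exists (fun l => conj_idem l gN).
have gU : g \in unitmx by have [] := gN.
have b_ex l : exists m, b l m.
  apply/existsP; apply: contraT => /existsPn bl.
  have : idem l = 0.
    apply: (conjmx_eq0 gU); rewrite bE -block_scal0; apply/eq_mxdiag => i.
    by apply/eq_mxdiag => k; rewrite (negPf (bl _)).
  by rewrite -block_scal0 => /block_scal_inj/(_ l)/eqP; rewrite eqxx oner_eq0.
have [f fP] := fin_all_exists b_ex.
have b_uniq l l' m : b l m -> b l' m -> l = l'.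
  move=> blm bl'm; apply/eqP; apply: contraT => ll'.
  (* Here and below, rewriting with an equation about [idem l] in a term that
     contains [idem (f l)] would unfold both; hence the lemmas on variables. *)
  have conj_mul0 A B A' B' : g *m A *m invmx g = A' -> g *m B *m invmx g = B' ->
      A *m B = 0 -> A' *m B' = 0.
    by move=> <- <- AB; rewrite conjmxM // AB mulmx0 mul0mx.
  have ee : idem l *m idem l' = 0 by rewrite idemM (negPf ll').
  have := conj_mul0 _ _ _ _ (bE l) (bE l') ee.
  rewrite block_scalM -block_scal0 => /block_scal_inj/(_ m)/eqP.
  by rewrite blm bl'm mulr1 oner_eq0.
have f_inj : injective f.
  by move=> l l' ff; apply: (b_uniq _ _ (f l)) => //; rewrite ff.
exists f; first exact: f_inj.
move=> l; suff E : g *m idem l *m invmx g = idem (f l) by rewrite -E mulmxKV.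
rewrite (bE l); apply/eq_mxdiag => i; apply/eq_mxdiag => k; congr (_%:R%:M).
(* An injective self-map of a finite set is onto, so every label is some f(m), and f(m) is in no
   support but that of m. *)
have [f' _ fK] := injF_bij f_inj; rewrite -[lab k]fK; move: (f' _) => m.
rewrite inj_eq //; congr nat_of_bool; apply/idP/eqP => [blm|->] //.
exact: b_uniq (fP m) blm.
Qed.

Lemma rank_idem l : \rank (idem l) = (n_ (tag l) * r)%N.
Proof.
rewrite rank_mxdiag.
under eq_bigr do rewrite rank_mxdiag.
rewrite sig_big_dep /= (bigD1 l) //= [X in (_ + X)%N]big1 => [|m ml].
  by case: l => i k; rewrite eqxx mxrank1 addn0 sum_nat_const card_ord.
by case: m ml => i k /negPf->; rewrite raddf0 mxrank0.
Qed.

Lemma normalizer_J_product g : GL_normalizer J_product g ->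
  exists2 u : forall i, 'M[F]_(\sum_(k < p_ i) d i), @W_product F s r n_ p_ u &
    exists2 h, J_product h & g = \mxdiag_i u i *m h.
Proof.
move=> gN; have [f f_inj fE] := conj_idem_perm gN.
have gU : g \in unitmx by have [] := gN.
(* Conjugation preserves the rank n_i r of an idempotent, and the n_i are distinct. *)
have tag_f l : tag (f l) = tag l.
  have /eqP := etrans (esym (rank_idem l))
    (etrans (mxrank_conj gU (fE l)) (rank_idem (f l))).
  by rewrite eqn_pmul2r // => /eqP/n_inj.
have sigma_ex i : exists t : 'S_(p_ i), forall k, f (lab k) = lab (t k).
  have t_ex (k : 'I_(p_ i)) : exists k' : 'I_(p_ i), f (lab k) = lab k'.
    move: (tag_f (lab k)); case: (f _) => j k' /= ji.
    by case: _ / ji in k' *; exists k'.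
  have [t tE] := fin_all_exists t_ex.
  have t_inj : injective t.
    move=> k k' /(congr1 (fun k => lab k)); rewrite -!tE => /f_inj/eqP.
    by rewrite eq_Tagged => /eqP.
  by exists (perm t_inj) => k; rewrite permE.
have [sigma sigmaE] := fin_all_exists sigma_ex.
pose P := \mxdiag_i @block_perm_mx F (d i) _ (sigma i).
have PU : P \in unitmx by apply: mxdiag_unit => i; apply: block_perm_unit.
have PN : GL_normalizer J_product P.
  by apply: mxdiag_normalizer => i; apply: block_perm_normalizer.
have PE l : P *m idem l = idem (f l) *m P.
  rewrite !mul_mxdiag; apply/eq_mxdiag => i; rewrite block_perm_diag.
  congr (_ *m _); apply/eq_mxdiag => k; congr (_%:R%:M).
  by rewrite -(inj_eq f_inj) sigmaE permKV.
have NG := GL_normalizer_subgroup J_product.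
have hN : GL_normalizer J_product (invmx P *m g).
  by apply: (mxsubM NG) => //; apply: (mxsubV NG).
(* P and g permute the idempotents in the same way, so P^-1 g commutes with all of them and is block
   diagonal. *)
have /comm_idemP hE l : comm_mx (invmx P *m g) (idem l) :=
  comm_mx_ratio PU (PE l) (fE l).
set X := fun i k => submxblock (submxblock (invmx P *m g) i i) k k in hE.
have wh i k : exists wh : 'M[F]_(d i) * 'M[F]_(d i),
    [/\ W wh.1, J wh.2 & X i k = wh.1 *m wh.2].
  have XN : GL_normalizer (@J F r (n_ i)) (X i k).
    rewrite hE in hN.
    have XiN := mxdiag_normalizerV i (fun j => mxsub1 (J_diag_subgroup j)) hN.
    apply: (mxdiag_normalizerV k _ XiN) => k'.
    exact: mxsub1 (J_subgroup _ _ _).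
  have [w Ww [h Jh E]] := normalizer_J (n0 i) r0 F2 XN.
  by exists (w, h).
have [w {}wh] := fin_all_exists (fun i => fin_all_exists (wh i)).
(* From g = P diag(w) diag(h), moving P to the right of diag(w) reindexes w by the inverse
   permutation. *)
pose w' i k := (w i ((sigma i)^-1%g k)).1.
exists (fun i => \mxdiag_k w' i k *m block_perm_mx F (d i) (sigma i)).
  move=> i; apply/W_wreathP; exists (w' i), (sigma i).
  by split=> // k; have [] := wh i ((sigma i)^-1%g k).
exists (\mxdiag_i \mxdiag_k (w i k).2).
  apply/J_productP; exists (fun i k => (w i k).2); last exact: erefl.
  by move=> i k; have [_ h2 _] := wh i k; exact: h2.
rewrite -[LHS](mulKVmx PU) hE !mul_mxdiag; apply/eq_mxdiag => i.
rewrite -(block_perm_diag _ (fun k => (w i k).1)) -mulmxA mul_mxdiag.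
congr (_ *m _).
by apply/eq_mxdiag => k; have [] := wh i k.
Qed.

End Normalizer.

(** * The isomorphism for the quotient *)

Section Isomorphism.

Variables (F : fieldType) (s r : nat) (n_ p_ : 'I_s -> nat).
Hypotheses (r0 : (0 < r)%N) (n0 : forall i, (0 < n_ i)%N) (F2 : 2 != 0 :> F).
Hypothesis n_inj : injective n_.
Local Notation d i := (\sum_(a < n_ i) r)%N.
Local Notation size := (\sum_i \sum_(k < p_ i) d i)%N.
Local Notation Wprod := (@W_product F s r n_ p_).
Local Notation mulW := (@pointwise_mul F s (fun i => \sum_(k < p_ i) d i)%N).

Lemma W_product_group : is_group mulW Wprod.
Proof.
have WG i := W_wreath_subgroup (p_ i) r0 (n0 i) F2.
have ext (u v : forall i, 'M[F]_(\sum_(k < p_ i) d i)) :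
    (forall i, u i = v i) -> u = v.
  exact: boolp.functional_extensionality_dep.
split.
- by move=> u v uW vW i; apply: (mxsubM (WG i)).
- by move=> u v w _ _ _; apply: ext => i; apply: mulmxA.
- exists (fun=> 1%:M) => [i|u uW]; first exact: (mxsub1 (WG i)).
  have uU i : u i \in unitmx by apply: (mxsub_unit (WG i)).
  split; [by apply: ext => i; apply: mul1mx|by apply: ext => i; apply: mulmx1|].
  exists (fun i => invmx (u i)) => [i|]; first exact: (mxsubV (WG i)).
  by split; apply: ext => i; [apply: mulVmx|apply: mulmxV].
Qed.

Lemma normalizer_quotient_J_product :
  group_isomorphic (@setwise_mul F size)
    (normalizer_quotient (@J_product F s r n_ p_)) mulW Wprod.
Proof.
apply: (complement_isomorphic (k := fun u => \mxdiag_i u i)).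
- exact: J_product_subgroup.
- exact: W_product_group.
- by move=> u uW; apply: mxdiag_normalizer => i; apply: W_wreath_normalizer.
- by move=> u v _ _; rewrite mul_mxdiag.
- move=> u uW uJ; rewrite -mxdiagZ; apply/eq_mxdiag => i.
  by apply: (W_wreath_J r0 (n0 i)) => //; apply: mxdiag_setP uJ.
- move=> u v _ _ /eq_mxdiagP uv; exact: boolp.functional_extensionality_dep.
- exact: normalizer_J_product.
Qed.

(* The size of the matrices is generalized so that the cast can be removed. *)
Lemma normalizer_quotient_cast M (e : size = M) :
  group_isomorphic (@setwise_mul F M)
    (normalizer_quotient [set A : 'M[F]_M |
       exists2 X : forall i : 'I_s, 'I_(p_ i) -> 'M[F]_(d i),
         forall i k, J (X i k)
         & A = castmx (e, e) (\mxdiag_i \mxdiag_(k < p_ i) X i k)])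
    mulW Wprod.
Proof.
case: M / e; rewrite (_ : [set A | _] = @J_product F s r n_ p_).
  exact: normalizer_quotient_J_product.
apply/seteqP; split=> A.
  by move=> [X XJ ->]; apply/J_productP; exists X; rewrite ?castmx_id.
by move=> /J_productP[X XJ ->]; exists X; rewrite ?castmx_id.
Qed.

End Isomorphism.

Local Open Scope complex_scope.

Theorem proposition3p8 (R : realType) (r n s : nat) (n_ p_ : 'I_s -> nat)
    (r_gt0 : (0 < r)%N) (n_gt0 : (0 < n)%N)
    (n_decr : forall i j : 'I_s, (i < j)%N -> (n_ j < n_ i)%N)
    (n__gt0 : forall i : 'I_s, (0 < n_ i)%N)
    (p__gt0 : forall i : 'I_s, (0 < p_ i)%N)
    (sum_pn : (\sum_(i < s) p_ i * n_ i)%N = n) :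
  group_isomorphic
    (@setwise_mul R[i] (n * r))
    (normalizer_quotient (@H_lambda R[i] s r n n_ p_ sum_pn))
    (@pointwise_mul R[i] s (fun i => \sum_(k < p_ i) \sum_(a < n_ i) r)%N)
    (@W_product R[i] s r n_ p_).
Proof.
apply: normalizer_quotient_cast => //.
  by rewrite Num.Theory.pnatr_eq0.
move=> i j nij; case: (ltngtP i j) => [/n_decr|/n_decr|/val_inj //];
  by rewrite nij ltnn.
Qed.
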